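(* Let $\mathsf{K}_1$ and $\mathsf{K}_2$ be categorically equivalent quasivarieties that algebraize deductive systems $\vdash_1$ and $\vdash_2$, respectively. If $\vdash_1$ has a weak excluded middle law (WEML), then so does $\vdash_2$.
   Context: A quasivariety is regarded as a category whose objects are its members and whose morphisms are all algebraic homomorphisms between them; categorically equivalent means equivalent as categories (the signatures may differ). Deductive systems. Fix an algebraic signature and an infinite set of variables; $\mathit{Fm}$ is the set of formulas (terms) and $\boldsymbol{Fm}$ the absolutely free algebra of formulas. Substitutions are endomorphisms of $\boldsymbol{Fm}$. A deductive system $\vdash$ is a relation from sets of formulas to formulas that is reflexive ($\Gamma\vdash\alpha$ if $\alpha\in\Gamma$), transitive (if $\Gamma\vdash\alpha$ for all $\alpha\in\Pi$ and $\Pi\vdash\beta$, then $\Gamma\vdash\beta$), finitary (if $\Gamma\vdash\alpha$ then $\Gamma'\vdash\alpha$ for some finite $\Gamma'\subseteq\Gamma$) and substitution-invariant (if $\Gamma\vdash\alpha$ then $s[\Gamma]\vdash s(\alpha)$ for every substitution $s$). $\Gamma\vdash\Pi$ means $\Gamma\vdash\alpha$ for all $\alpha\in\Pi$. Let $v_1,v_2,\dots$ be a fixed sequence of distinct variables, $\mathbb{N}^+=\{1,2,\dots\}$, and let $\mathit{Fm}(n)$ be the set of formulas whose variables are among $v_1,\dots,v_n$. For $\Psi\subseteq\mathit{Fm}(n)$, $\Psi(\alpha_1,\dots,\alpha_n)$ denotes the result of substituting $\alpha_i$ for $v_i$ in all members of $\Psi$. WEML. A set $\Xi$ of formulas is inconsistent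 in $\vdash$ if $\Xi\vdash\alpha$ for all $\alpha\in\mathit{Fm}$. An elementary IL-sequence for $\vdash$ is a family $\{\Psi_n:n\in\mathbb{N}^+\}$ of finite sets $\Psi_n\subseteq\mathit{Fm}(n)$ such that for all $n\in\mathbb{N}^+$ and all $\Gamma\cup\{\alpha_1,\dots,\alpha_n\}\subseteq\mathit{Fm}$: $\Gamma\cup\{\alpha_1,\dots,\alpha_n\}$ is inconsistent in $\vdash$ iff $\Gamma\vdash\Psi_n(\alpha_1,\dots,\alpha_n)$. Given such a sequence, let $\#n=|\Psi_n|$, $\Psi_n=\{\psi_n^1,\dots,\psi_n^{\#n}\}$ and $\Psi_{\#n}\Psi_n=\Psi_{\#n}(\psi_n^1,\dots,\psi_n^{\#n})\subseteq\mathit{Fm}(n)$ (the order of enumeration is immaterial up to interderivability). $\vdash$ has a WEML if it has an elementary IL-sequence $\{\Psi_n\}$ such that for all $n\in\mathbb{N}^+$ and all $\Gamma\cup\{\alpha_1,\dots,\alpha_n,\varphi\}\subseteq\mathit{Fm}$: if $\Gamma\cup\Psi_n(\alpha_1,\dots,\alpha_n)\vdash\varphi$ and $\Gamma\cup\Psi_{\#n}\Psi_n(\alpha_1,\dots,\alpha_n)\vdash\varphi$, then $\Gamma\vdash\varphi$. (If $\Psi_n=\emptyset$, this condition for $n$ is trivially true.) Algebraization. Algebras are non-empty and have the signature of $\vdash$. A $\vdash$-filter of an algebra $\boldsymbol{A}$ is a set $F\subseteq A$ such that whenever $\Gamma\vdash\alpha$ and $h\colon\boldsymbol{Fm}\to\boldsymbol{A}$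 is a homomorphism with $h[\Gamma]\subseteq F$, then $h(\alpha)\in F$. The $\vdash$-filters of $\boldsymbol{A}$ form a complete lattice under inclusion. A congruence $\theta$ of $\boldsymbol{A}$ is compatible with $F\subseteq A$ if $F$ is a union of $\theta$-classes; $\Omega^{\boldsymbol{A}}F$ is the largest congruence of $\boldsymbol{A}$ compatible with $F$. For a quasivariety $\mathsf{K}$, the $\mathsf{K}$-congruences of $\boldsymbol{A}$ are the congruences $\theta$ with $\boldsymbol{A}/\theta\in\mathsf{K}$, ordered by inclusion. $\mathsf{K}$ algebraizes $\vdash$ if, for every algebra $\boldsymbol{A}$, the map $F\mapsto\Omega^{\boldsymbol{A}}F$ is an isomorphism from the lattice of $\vdash$-filters of $\boldsymbol{A}$ onto the lattice of $\mathsf{K}$-congruences of $\boldsymbol{A}$. *)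

(* Defs.v *)
From HB Require Import structures.
From mathcomp Require Import all_boot generic_quotient finmap.
From mathcomp Require Import boolp classical_sets functions cardinality.

Set Implicit Arguments.
Unset Strict Implicit.
Unset Printing Implicit Defensive.

Local Open Scope quotient_scope.
Local Open Scope classical_set_scope.

Record signature := Signature {
  op : Type;
  arity : op -> nat
}.

Record algebra (S : signature) := Algebra {
  carrier :> Type;
  interp : forall f : op S, ('I_(arity f) -> carrier) -> carrier;
  carrier_nonempty : inhabited carrier
}.
Arguments interp {S} a f _.

Record hom (S : signature) (A B : algebra S) := Hom {
  hom_fun :> A -> B;
  hom_interp : forall (f : op S) (args : 'I_(arity f) -> A),
    hom_fun (interp A f args) = interp B f (fun i => hom_fun (args i))
}.

Lemma hom_ext (S : signature) (A B : algebra S) (g h : hom A B) :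
  (forall x, g x = h x) -> g = h.
Proof.
case: g h => [g gP] [h hP] /= gh; have {}gh : g = h by apply/funext.
by case: _ / gh hP => hP; congr Hom; apply: Prop_irrelevance.
Qed.

Definition hom_id (S : signature) (A : algebra S) : hom A A :=
  @Hom S A A id (fun _ _ => erefl).

Lemma hom_comp_interp (S : signature) (A B C : algebra S)
    (h : hom B C) (g : hom A B) (f : op S) (args : 'I_(arity f) -> A) :
  h (g (interp A f args)) = interp C f (fun i => h (g (args i))).
Proof. by rewrite !hom_interp. Qed.

Definition hom_comp (S : signature) (A B C : algebra S)
    (h : hom B C) (g : hom A B) : hom A C :=
  @Hom S A C (fun x => h (g x)) (@hom_comp_interp S A B C h g).

Inductive term (S : signature) (X : Type) : Type :=
| Var of X
| App (f : op S) of ('I_(arity f) -> term S X).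
Arguments Var {S X}.
Arguments App {S X}.

HB.instance Definition _ (S : signature) (X : Type) := gen_eqMixin (term S X).
HB.instance Definition _ (S : signature) (X : Type) :=
  gen_choiceMixin (term S X).

Fixpoint term_vars (S : signature) (X : Type) (t : term S X) : set X :=
  match t with
  | Var x => [set x]
  | App _ args => \bigcup_i term_vars (args i)
  end.

Fixpoint eval (S : signature) (X : Type) (A : algebra S) (a : X -> A)
    (t : term S X) : A :=
  match t with
  | Var x => a x
  | App f args => interp A f (fun i => eval a (args i))
  end.

Record congruence (S : signature) (A : algebra S) := Congruence {
  cong_rel :> A -> A -> Prop;
  cong_refl : forall x, cong_rel x x;
  cong_sym : forall x y, cong_rel x y -> cong_rel y x;
  cong_trans : forall x y z, cong_rel x y -> cong_rel y z -> cong_rel x z;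
  cong_interp : forall (f : op S) (a b : 'I_(arity f) -> A),
    (forall i, cong_rel (a i) (b i)) -> cong_rel (interp A f a) (interp A f b)
}.

Definition cong_le (S : signature) (A : algebra S) (t u : congruence A) : Prop :=
  forall x y, t x y -> u x y.

Section Quotient.
Variables (S : signature) (A : algebra S) (t : congruence A).

Definition cong_bool (x y : {classic A}) : bool := `[< t x y >].

Lemma cong_bool_refl : reflexive cong_bool.
Proof. by move=> x; apply/asboolP/cong_refl. Qed.

Lemma cong_bool_sym : symmetric cong_bool.
Proof. by move=> x y; apply/asboolP/asboolP; apply: cong_sym. Qed.

Lemma cong_bool_trans : transitive cong_bool.
Proof. by move=> y x z /asboolP xy /asboolP yz; apply/asboolP/(cong_trans xy). Qed.

Definition cong_equiv : equiv_rel {classic A} :=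
  EquivRel cong_bool cong_bool_refl cong_bool_sym cong_bool_trans.

Definition quot_carrier : Type := {eq_quot cong_equiv}.

Definition quot_class (x : A) : quot_carrier :=
  \pi_({eq_quot cong_equiv}) (x : {classic A}).

Definition quot_repr (c : quot_carrier) : A :=
  repr (c : {eq_quot cong_equiv}).

Lemma quot_nonempty : inhabited quot_carrier.
Proof. by case: (carrier_nonempty A) => x; exists; exact: quot_class x. Qed.

Definition quotient : algebra S :=
  @Algebra S quot_carrier
    (fun f args => quot_class (interp A f (fun i => quot_repr (args i))))
    quot_nonempty.

Lemma quot_class_eq (x y : A) : quot_class x = quot_class y <-> t x y.
Proof.
rewrite /quot_class; split.
  by move=> /eqP; rewrite eqmodE /= => /asboolP.
by move=> txy; apply/eqP; rewrite eqmodE /=; apply/asboolP.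
Qed.

Lemma quot_class_repr (c : quot_carrier) : quot_class (quot_repr c) = c.
Proof. exact: reprK. Qed.

Lemma quot_class_interp (f : op S) (args : 'I_(arity f) -> A) :
  quot_class (interp A f args) =
  interp quotient f (fun i => quot_class (args i)).
Proof.
apply/quot_class_eq/cong_interp => i.
by apply/quot_class_eq; rewrite quot_class_repr.
Qed.

End Quotient.

(* A finite (possibly empty) list of premises and a conclusion; a pair of
   terms stands for an equation.  Variables are indexed by [nat]. *)
Definition equation (S : signature) : Type := (term S nat * term S nat)%type.

Record quasi_equation (S : signature) := QuasiEquation {
  premises : seq (equation S);
  conclusion : equation S
}.

Definition satisfies (S : signature) (A : algebra S) (q : quasi_equation S) : Prop :=
  forall a : nat -> A,
    (forall e, e \in premises q -> eval a e.1 = eval a e.2) ->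
    eval a (conclusion q).1 = eval a (conclusion q).2.

Definition quasivariety (S : signature) (K : algebra S -> Prop) : Prop :=
  exists Q : set (quasi_equation S),
    forall A : algebra S, K A <-> (forall q, Q q -> satisfies A q).

Record category := Category {
  obj :> Type;
  mor : obj -> obj -> Type;
  idm : forall x, mor x x;
  comp : forall x y z, mor y z -> mor x y -> mor x z;
  comp_idl : forall x y (g : mor x y), comp (idm y) g = g;
  comp_idr : forall x y (g : mor x y), comp g (idm x) = g;
  comp_assoc : forall x y z w (h : mor z w) (g : mor y z) (f : mor x y),
    comp h (comp g f) = comp (comp h g) f
}.
Arguments mor {c} x y.
Arguments idm {c} x.
Arguments comp {c x y z} _ _.

Record functor (C D : category) := Functor {
  fobj :> C -> D;
  fmap : forall x y : C, mor x y -> mor (fobj x) (fobj y);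
  fmap_id : forall x, fmap (idm x) = idm (fobj x);
  fmap_comp : forall x y z (h : mor y z) (g : mor x y),
    fmap (comp h g) = comp (fmap h) (fmap g)
}.
Arguments fmap {C D} f {x y} _.

Definition functor_id (C : category) : functor C C :=
  @Functor C C id (fun _ _ g => g) (fun _ => erefl) (fun _ _ _ _ _ => erefl).

Section FunctorComp.
Variables (C D E : category) (G : functor D E) (F : functor C D).

Lemma fmap_comp_id (x : C) : fmap G (fmap F (idm x)) = idm (G (F x)).
Proof. by rewrite !fmap_id. Qed.

Lemma fmap_comp_comp (x y z : C) (h : mor y z) (g : mor x y) :
  fmap G (fmap F (comp h g)) = comp (fmap G (fmap F h)) (fmap G (fmap F g)).
Proof. by rewrite !fmap_comp. Qed.

Definition functor_comp : functor C E :=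
  @Functor C E (fun x => G (F x)) (fun _ _ g => fmap G (fmap F g))
    fmap_comp_id fmap_comp_comp.
End FunctorComp.

Definition isomorphism (C : category) (x y : C) (g : mor x y) : Prop :=
  exists h : mor y x, comp h g = idm x /\ comp g h = idm y.

Definition naturally_isomorphic (C D : category) (F G : functor C D) : Prop :=
  exists eta : forall x : C, mor (F x) (G x),
    (forall (x y : C) (g : mor x y),
        comp (eta y) (fmap F g) = comp (fmap G g) (eta x)) /\
    (forall x : C, isomorphism (eta x)).

Definition equivalent_categories (C D : category) : Prop :=
  exists (F : functor C D) (G : functor D C),
    naturally_isomorphic (functor_comp G F) (functor_id C) /\
    naturally_isomorphic (functor_comp F G) (functor_id D).

Definition category_of (S : signature) (K : algebra S -> Prop) : category.
Proof.
refine (@Category {A : algebra S | K A}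
  (fun A B => hom (proj1_sig A) (proj1_sig B))
  (fun A => hom_id (proj1_sig A))
  (fun A B C h g => hom_comp h g) _ _ _).
all: by move=> *; apply: hom_ext.
Defined.

(* An infinite set of variables with a fixed sequence of distinct elements;
   [vseq i] is the variable [v_(i+1)]. *)
Record variables := Variables {
  variable :> Type;
  vseq : nat -> variable;
  vseq_inj : injective vseq
}.

Definition Fm (S : signature) (V : variables) : algebra S :=
  @Algebra S (term S V) (@App S V) (inhabits (Var (vseq V 0))).

Definition Fmn (S : signature) (V : variables) (n : nat) : set (term S V) :=
  [set t | term_vars t `<=` vseq V @` [set i | i < n]].

(* The substitution sending [v_1, ..., v_n] to [alpha_1, ..., alpha_n] and
   fixing the other variables (it is only applied to members of [Fmn n]). *)
Definition inst_var (S : signature) (V : variables) (n : nat)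
    (alpha : 'I_n -> term S V) (x : V) : term S V :=
  if [pick i : 'I_n | `[< vseq V i = x >]] is Some i then alpha i else Var x.

Definition inst (S : signature) (V : variables) (n : nat)
    (Psi : set (term S V)) (alpha : 'I_n -> term S V) : set (term S V) :=
  @eval S V (Fm S V) (inst_var alpha) @` Psi.

Record deductive_system (S : signature) (V : variables) := DeductiveSystem {
  derives :> set (term S V) -> term S V -> Prop;
  derives_refl : forall (Gamma : set (term S V)) alpha,
    Gamma alpha -> derives Gamma alpha;
  derives_trans : forall (Gamma Pi : set (term S V)) beta,
    (forall alpha, Pi alpha -> derives Gamma alpha) ->
    derives Pi beta -> derives Gamma beta;
  derives_finitary : forall (Gamma : set (term S V)) alpha,
    derives Gamma alpha ->
    exists Gamma' : set (term S V),
      [/\ finite_set Gamma', Gamma' `<=` Gamma & derives Gamma' alpha];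
  derives_subst : forall (s : hom (Fm S V) (Fm S V)) (Gamma : set (term S V)) alpha,
    derives Gamma alpha -> derives (s @` Gamma) (s alpha)
}.

Definition derives_all (S : signature) (V : variables) (D : deductive_system S V)
    (Gamma Pi : set (term S V)) : Prop :=
  forall alpha, Pi alpha -> D Gamma alpha.

Definition inconsistent (S : signature) (V : variables)
    (D : deductive_system S V) (Xi : set (term S V)) : Prop :=
  forall alpha, D Xi alpha.

(* Families indexed by the positive integers are functions on [nat] whose
   value at 0 is irrelevant. *)
Definition elementary_IL_sequence (S : signature) (V : variables)
    (D : deductive_system S V) (Psi : nat -> {fset term S V}) : Prop :=
  forall n : nat, 0 < n ->
    [set` Psi n] `<=` @Fmn S V n /\
    forall (Gamma : set (term S V)) (alpha : 'I_n -> term S V),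
      inconsistent D (Gamma `|` range alpha) <->
      derives_all D Gamma (inst [set` Psi n] alpha).

Definition enumeration (S : signature) (V : variables) (A : {fset term S V}) :
    'I_(#|` A|) -> term S V :=
  tnth (in_tuple (enum_fset A)).

Definition Psi_Psi (S : signature) (V : variables)
    (Psi : nat -> {fset term S V}) (n : nat) : set (term S V) :=
  inst [set` Psi #|` Psi n|] (enumeration (A := Psi n)).

(* When [Psi n] is empty, [Psi_Psi Psi n] involves the irrelevant [Psi 0], but
   the first premise then already gives [D Gamma phi]. *)
Definition has_WEML (S : signature) (V : variables)
    (D : deductive_system S V) : Prop :=
  exists Psi : nat -> {fset term S V},
    elementary_IL_sequence D Psi /\
    forall n : nat, 0 < n ->
    forall (Gamma : set (term S V)) (alpha : 'I_n -> term S V) (phi : term S V),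
      D (Gamma `|` inst [set` Psi n] alpha) phi ->
      D (Gamma `|` inst (Psi_Psi Psi n) alpha) phi ->
      D Gamma phi.

Definition is_filter (S : signature) (V : variables) (D : deductive_system S V)
    (A : algebra S) (F : set A) : Prop :=
  forall (Gamma : set (term S V)) alpha, D Gamma alpha ->
  forall h : hom (Fm S V) A, h @` Gamma `<=` F -> F (h alpha).

(* [F] is a union of [t]-classes. *)
Definition compatible (S : signature) (A : algebra S) (t : congruence A)
    (F : set A) : Prop :=
  forall x y, t x y -> F x -> F y.

Definition largest_compatible (S : signature) (A : algebra S) (F : set A)
    (t : congruence A) : Prop :=
  compatible t F /\ forall u : congruence A, compatible u F -> cong_le u t.

Section LeibnizCongruence.
Variables (S : signature) (A : algebra S).

Inductive polynomial : (A -> A) -> Prop :=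
| poly_id : polynomial id
| poly_const (c : A) : polynomial (fun=> c)
| poly_interp (f : op S) (p : 'I_(arity f) -> A -> A) :
    (forall i, polynomial (p i)) ->
    polynomial (fun x => interp A f (fun i => p i x)).

Lemma polynomial_comp p q :
  polynomial p -> polynomial q -> polynomial (fun x => p (q x)).
Proof.
move=> pp pq; elim: pp => //= [c|f r _ IH]; first exact: poly_const.
exact: (poly_interp (p := fun i x => r i (q x))).
Qed.

Lemma polynomial_cong (t : congruence A) p x y :
  polynomial p -> t x y -> t (p x) (p y).
Proof.
move=> pp txy; elim: pp => //= [c|f r _ IH]; first exact: cong_refl.
exact: cong_interp.
Qed.

Definition indiscernible (F : set A) (x y : A) : Prop :=
  forall p, polynomial p -> (F (p x) <-> F (p y)).

Lemma indiscernible_interp (F : set A) (f : op S) (a b : 'I_(arity f) -> A) :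
  (forall i, indiscernible F (a i) (b i)) ->
  indiscernible F (interp A f a) (interp A f b).
Proof.
move=> ab p pp.
pose m k (i : 'I_(arity f)) := if i < k then b i else a i.
have step k : k <= arity f ->
    (F (p (interp A f a)) <-> F (p (interp A f (m k)))).
  elim: k => [|k IH] kf.
    by have -> : m 0 = a by apply/funext.
  rewrite (IH (ltnW kf)).
  pose j := Ordinal kf.
  pose r x i := if i == j then x else m k i.
  have -> : m k.+1 = r (b j).
    apply/funext => i; rewrite /r; case: (eqVneq i j) => [->|ij].
      by rewrite /m /= ltnSn.
    rewrite /m ltnS leq_eqVlt; suff -> : (i == k :> nat) = false by [].
    exact: negbTE ij.
  have -> : m k = r (a j).
    by apply/funext => i; rewrite /r; case: eqVneq => // ->; rewrite /m ltnn.
  apply: (ab j (fun x => p (interp A f (r x)))).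
  apply: (polynomial_comp pp).
  apply: (poly_interp (p := fun i x => r x i)) => i; rewrite /r.
  by case: (i == j); [exact: poly_id|exact: poly_const].
have -> : b = m (arity f) by apply/funext => i; rewrite /m ltn_ord.
exact: step.
Qed.

Definition indiscernibility (F : set A) : congruence A.
Proof.
refine (@Congruence S A (indiscernible F) _ _ _ (@indiscernible_interp F)).
- by [].
- by move=> x y xy p pp; rewrite (xy p pp).
- by move=> x y z xy yz p pp; rewrite (xy p pp); exact: yz.
Defined.

Lemma largest_compatible_exists (F : set A) :
  exists t : congruence A, largest_compatible F t.
Proof.
exists (indiscernibility F); split=> [x y /(_ id poly_id) [] //|u uF x y uxy p pp].
have upq := polynomial_cong pp uxy.
by split; apply: uF => //; apply: cong_sym.
Qed.

Definition Leibniz (F : set A) : congruence A :=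
  sval (cid (largest_compatible_exists F)).

Lemma LeibnizP (F : set A) : largest_compatible F (Leibniz F).
Proof. exact: svalP. Qed.

End LeibnizCongruence.

Definition is_K_congruence (S : signature) (K : algebra S -> Prop)
    (A : algebra S) (t : congruence A) : Prop :=
  K (quotient t).

(* An isomorphism between lattices is the same as an order isomorphism. *)
Definition algebraizes (S : signature) (V : variables)
    (K : algebra S -> Prop) (D : deductive_system S V) : Prop :=
  forall A : algebra S,
    set_bij [set F : set A | is_filter D F] [set t | is_K_congruence K t]
      (@Leibniz S A) /\
    forall F G : set A, is_filter D F -> is_filter D G ->
      (F `<=` G <-> cong_le (Leibniz F) (Leibniz G)).

(* Main.v *)
From mathcomp Require Import all_boot finmap.
From mathcomp Require Import boolp classical_sets functions cardinality.
Require Import Defs.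

(** A weak excluded middle law amounts to a purely order-theoretic property of
    lattices of filters, and categorical equivalence preserves these lattices.

    Call a preorder dually Stone if every compact element [a] has a compact
    dual pseudo-complement [a*] (the least element whose join with [a] is the
    top) and the meet of [a*] and [a**] is the bottom, relative to every
    element.

    If a system with a WEML is algebraized by a quasivariety, the lattice of its
    filters on every algebra [A] is dually Stone ([WEML_dually_stone]).  The
    compact filters are those generated by finitely many elements
    [a_1, ..., a_n], and [Psi_n (a_1, ..., a_n)] generates the dual
    pseudo-complement.  The law is given for sets of formulas only, so it has
    to be carried over to [A], which may be larger than the set of variables.
    A membership in a generated filter has a finite cause.  Hence, for every
    homomorphism [h] from formulas to [A] whose range contains a suitable
    finite set, it comes from a derivation between preimages
    ([generated_lifted]); the kernel of [h] causes no trouble because the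
    Leibniz operator is monotone ([theory_saturated]).

    Conversely, if the lattice of theories is dually Stone, then the system has
    a WEML ([dually_stone_WEML]).  A finite set of generators of the dual
    pseudo-complement of the theory of [v_1, ..., v_n] gives [Psi_n] once its
    superfluous variables are identified with [v_1].

    It remains to compare lattices.  Filters correspond to relative congruences,
    that is, to surjective homomorphisms into the quasivariety, up to
    isomorphism.  In a quasivariety the surjections are exactly the morphisms
    that factor through no proper monomorphism ([extremal_surjective]), which is
    a categorical notion.  So an equivalence identifies the theories of the
    second system, which correspond to the quotients of the free algebra, with
    the filters of the first system on the image of the free algebra
    ([filter_quotient_equiv], [quotient_equiv]). *)

Set Implicit Arguments.
Unset Strict Implicit.
Unset Printing Implicit Defensive.

Local Open Scope classical_set_scope.

(** * Dually Stone preorders *)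

Section DuallyStone.
Variables (T : Type) (le : T -> T -> Prop).

(** Families are bare predicates: the universe of [set] is bounded by that of
    the carriers of algebras, below the objects of a category of algebras. *)
Definition directed (Q : T -> Prop) : Prop :=
  (exists x, Q x) /\ forall x y, Q x -> Q y ->
    exists z, [/\ Q z, le x z & le y z].

Definition is_lub (Q : T -> Prop) (s : T) : Prop :=
  (forall x, Q x -> le x s) /\ forall u, (forall x, Q x -> le x u) -> le s u.

Definition compact (a : T) : Prop :=
  forall Q s, directed Q -> is_lub Q s -> le a s -> exists2 x, Q x & le a x.

(** The inequality between [y] and the join of [x] and [b], in a form that makes
    sense when joins are not known to exist. *)
Definition below_join (y x b : T) : Prop :=
  forall z, le x z -> le b z -> le y z.

(** [b] is a dual pseudo-complement of [a]: the least element whose join with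
    [a] is the top. *)
Definition dual_pc (a b : T) : Prop :=
  forall x, (forall w, below_join w x a) <-> le b x.

(** The second clause is the dual Stone identity for [b = a*] and [c = a**];
    joining with an arbitrary [x] makes up for the lack of distributivity. *)
Definition dually_stone : Prop :=
  (forall a, compact a -> exists2 b, compact b & dual_pc a b) /\
  (forall a b c, compact a -> dual_pc a b -> dual_pc b c ->
    forall x y, below_join y x b -> below_join y x c -> le y x).

End DuallyStone.

(** A total and surjective relation that preserves and reflects the order is an
    isomorphism between the posets that underlie two preorders.  Relations are
    used because they can be inverted without a choice of representatives. *)
Definition order_equiv (T U : Type) (leT : T -> T -> Prop)
    (leU : U -> U -> Prop) (R : T -> U -> Prop) : Prop :=
  [/\ forall x, exists y, R x y,
      forall y, exists x, R x y &
      forall x y x' y', R x x' -> R y y' -> leT x y <-> leU x' y'].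

Lemma order_equiv_sym (T U : Type) leT leU (R : T -> U -> Prop) :
  order_equiv leT leU R -> order_equiv leU leT (fun y x => R x y).
Proof.
by case=> [tot sur mon]; split=> // x y x' y' xx' yy'; rewrite (mon x' y' x y).
Qed.

Section OrderEquiv.
Variables (T U : Type) (leT : T -> T -> Prop) (leU : U -> U -> Prop).
Variable R : T -> U -> Prop.
Hypothesis eqR : order_equiv leT leU R.

Lemma compact_equiv a a' : R a a' -> compact leT a -> compact leU a'.
Proof.
case: eqR => tot sur mon aa' cpt Q s [[q0 Qq0] dirQ] [ubs lubs] a's.
have [t ts] := sur s.
suff [x [x' Qx' xx'] ax] : exists2 x, (exists2 x', Q x' & R x x') & leT a x.
  by exists x' => //; apply/(mon _ _ _ _ aa' xx').
apply: (cpt (fun x => exists2 x', Q x' & R x x') t).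
- split=> [|x y [x' Qx' xx'] [y' Qy' yy']].
    by have [x xq0] := sur q0; exists x, q0.
  have [z' [Qz' xz yz]] := dirQ _ _ Qx' Qy'; have [z zz'] := sur z'.
  exists z; split; first by exists z'.
    by apply/(mon _ _ _ _ xx' zz').
  by apply/(mon _ _ _ _ yy' zz').
- split=> [x [x' Qx' xx']|u ubu]; first by apply/(mon _ _ _ _ xx' ts)/ubs.
  have [u' uu'] := tot u; apply/(mon _ _ _ _ ts uu')/lubs => x' Qx'.
  by have [x xx'] := sur x'; apply/(mon _ _ _ _ xx' uu')/ubu; exists x'.
by apply/(mon _ _ _ _ aa' ts).
Qed.

Lemma below_join_equiv y x b y' x' b' : R y y' -> R x x' -> R b b' ->
  below_join leT y x b -> below_join leU y' x' b'.
Proof.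
case: eqR => _ sur mon yy' xx' bb' yxb z' xz bz; have [z zz'] := sur z'.
by apply/(mon _ _ _ _ yy' zz')/yxb; [apply/(mon _ _ _ _ xx' zz')
                                    |apply/(mon _ _ _ _ bb' zz')].
Qed.

End OrderEquiv.

Lemma dual_pc_equiv (T U : Type) leT leU (R : T -> U -> Prop) a b a' b' :
  order_equiv leT leU R -> R a a' -> R b b' ->
  dual_pc leT a b -> dual_pc leU a' b'.
Proof.
move=> eqR aa' bb' ab x'; have [tot sur mon] := eqR; have [x xx'] := sur x'.
rewrite -(mon _ _ _ _ bb' xx') -ab; split=> top w.
  have [w' ww'] := tot w.
  exact: (below_join_equiv (order_equiv_sym eqR) ww' xx' aa').
by have [v vw] := sur w; exact: (below_join_equiv eqR vw xx' aa').
Qed.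

Lemma dually_stone_equiv (T U : Type) leT leU (R : T -> U -> Prop) :
  order_equiv leT leU R -> dually_stone leT -> dually_stone leU.
Proof.
move=> eqR [pcT stT]; have eqV := order_equiv_sym eqR.
have [tot sur mon] := eqR; split=> [a' ca'|a' b' c' ca' ab' bc' x' y' yxb yxc].
  have [a aa'] := sur a'.
  have [b cb ab] := pcT a (compact_equiv eqV aa' ca').
  have [b' bb'] := tot b; exists b'; first exact: (compact_equiv eqR bb').
  exact: (dual_pc_equiv eqR aa' bb').
have [[a aa'] [b bb'] [c cc']] := And3 (sur a') (sur b') (sur c').
have [[x xx'] [y yy']] := (sur x', sur y').
apply/(mon _ _ _ _ yy' xx')/(stT a b c).
- exact: (compact_equiv eqV aa').
- exact: (dual_pc_equiv eqV aa' bb').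
- exact: (dual_pc_equiv eqV bb' cc').
- exact: (below_join_equiv eqV yy' xx' bb').
- exact: (below_join_equiv eqV yy' xx' cc').
Qed.

(** * Extremal quotients under an equivalence of categories *)

Definition mono (C : category) (x y : C) (m : mor x y) : Prop :=
  forall z (g h : mor z x), comp m g = comp m h -> g = h.

Definition extremal (C : category) (x y : C) (f : mor x y) : Prop :=
  forall z (g : mor x z) (m : mor z y), mono m -> comp m g = f ->
  isomorphism m.

Record extremal_quotient (C : category) (x : C) := ExtremalQuotient {
  quotient_target : C;
  quotient_mor : mor x quotient_target;
  quotient_extremal : extremal quotient_mor
}.
Arguments quotient_extremal {C x} _ [z g m].

Definition quotient_le (C : category) (x : C)
    (p q : extremal_quotient x) : Prop :=
  exists h : mor (quotient_target p) (quotient_target q),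
    comp h (quotient_mor p) = quotient_mor q.

Lemma iso_comp (C : category) (x y z : C) (g : mor y z) (f : mor x y) :
  isomorphism g -> isomorphism f -> isomorphism (comp g f).
Proof.
move=> [g' [g'g gg']] [f' [f'f ff']]; exists (comp f' g'); split.
  by rewrite comp_assoc -(comp_assoc f') g'g comp_idr f'f.
by rewrite comp_assoc -(comp_assoc g) ff' comp_idr gg'.
Qed.

Lemma iso_mono (C : category) (x y : C) (f : mor x y) : isomorphism f -> mono f.
Proof.
move=> [f' [f'f _]] z g h /(congr1 (comp f')).
by rewrite !comp_assoc f'f !comp_idl.
Qed.

Lemma iso_cancel_right (C : category) (x y z : C) (f : mor x y)
    (g h : mor y z) : isomorphism f -> comp g f = comp h f -> g = h.
Proof.
move=> [f' [_ ff']] /(congr1 (fun k => comp k f')).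
by rewrite -!comp_assoc ff' !comp_idr.
Qed.

Lemma mono_comp (C : category) (x y z : C) (g : mor y z) (f : mor x y) :
  mono g -> mono f -> mono (comp g f).
Proof. by move=> mg mf w a b; rewrite -!comp_assoc => /mg/mf. Qed.

(** Unlike an equivalence, this notion names a single functor. *)
Definition weak_equivalence (C D : category) (F : functor C D) : Prop :=
  [/\ forall (x y : C) (f g : mor x y), fmap F f = fmap F g -> f = g,
      forall (x y : C) (h : mor (F x) (F y)), exists f : mor x y, fmap F f = h &
      forall z, exists (x : C) (i : mor (F x) z), isomorphism i].

Lemma equivalent_weak_equivalence (C D : category) :
  equivalent_categories C D -> exists F : functor C D, weak_equivalence F.
Proof.
move=> [F [G [[eta [natE isoE]] [eps [natD isoD]]]]]; exists F.
have faithG (x y : D) (f g : mor x y) : fmap G f = fmap G g -> f = g.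
  move=> fg; apply: (iso_cancel_right (isoD x)).
  by have := natD _ _ f; rewrite /= fg => <-; exact: natD.
split=> [x y f g fg|x y h|z]; last by exists (G z), (eps z); exact: isoD.
  apply: (iso_cancel_right (isoE x)).
  by have := natE _ _ f; rewrite /= fg => <-; exact: natE.
have [k [kE Ek]] := isoE x.
exists (comp (eta y) (comp (fmap G h) k)); apply: faithG.
apply: (iso_mono (isoE y)).
by rewrite (natE _ _ (comp _ _)) /= -!comp_assoc kE comp_idr.
Qed.

Section WeakEquivalence.
Variables (C D : category) (F : functor C D).
Hypothesis weqF : weak_equivalence F.

Lemma fmap_iso (x y : C) (f : mor x y) :
  isomorphism (fmap F f) <-> isomorphism f.
Proof.
have [faith full _] := weqF; split=> [[h []]|[h []]].
  have [g <-] := full _ _ h.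
  rewrite -!fmap_comp -!fmap_id => /faith gf /faith fg.
  by exists g.
by move=> hf fh; exists (fmap F h); rewrite -!fmap_comp hf fh !fmap_id.
Qed.

Lemma fmap_mono (x y : C) (f : mor x y) : mono (fmap F f) <-> mono f.
Proof.
have [faith full esur] := weqF; split=> mf z g h.
  by move=> fgh; apply/faith/mf; rewrite -!fmap_comp fgh.
have [w [i iI]] := esur z => fgh; apply: (iso_cancel_right iI).
have [[g' g'E] [h' h'E]] := (full _ _ (comp g i), full _ _ (comp h i)).
rewrite -g'E -h'E; congr fmap; apply/mf/faith.
by rewrite !fmap_comp g'E h'E !comp_assoc fgh.
Qed.

Lemma fmap_extremal (x y : C) (f : mor x y) :
  extremal (fmap F f) <-> extremal f.
Proof.
have [faith full esur] := weqF; split=> ef z g m mm mg.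
  apply/fmap_iso/(ef _ (fmap F g)); first exact/fmap_mono.
  by rewrite -fmap_comp mg.
have [w [i iI]] := esur z; have [j [ji ij]] := iI.
have [[m' m'E] [g' g'E]] := (full _ _ (comp m i), full _ _ (comp j g)).
have : isomorphism m'.
  apply: (ef _ g').
    by apply/fmap_mono; rewrite m'E; apply: mono_comp => //; exact: iso_mono.
  apply/faith; rewrite fmap_comp m'E g'E -comp_assoc (comp_assoc i) ij.
  by rewrite comp_idl.
move=> /fmap_iso; rewrite m'E => im.
rewrite -[m]comp_idr -ij comp_assoc; apply: iso_comp => //.
by exists i.
Qed.

Lemma extremal_iso (x y z : D) (i : mor y z) (f : mor x y) :
  isomorphism i -> extremal f -> extremal (comp i f).
Proof.
move=> iI ef w g m mm mg; have [j [ji ij]] := iI.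
have mj : mono j by apply: iso_mono; exists i.
have : isomorphism (comp j m).
  apply: (ef _ g); first exact: mono_comp.
  by rewrite -comp_assoc mg comp_assoc ji comp_idl.
move=> /(iso_comp iI); by rewrite comp_assoc ij comp_idl.
Qed.

(** Since extremality is preserved and reflected, the extremal quotients of [x]
    correspond to those of [F x]. *)
Lemma quotient_equiv (x : C) :
  order_equiv (@quotient_le C x) (@quotient_le D (F x))
    (fun p q => exists i : mor (F (quotient_target p)) (quotient_target q),
       isomorphism i /\ comp i (fmap F (quotient_mor p)) = quotient_mor q).
Proof.
have [faith full esur] := weqF; split=> [p|q|].
- exists (ExtremalQuotient (proj2 (fmap_extremal _) (quotient_extremal p))).
  by exists (idm _); split; [exists (idm _); rewrite comp_idl|rewrite comp_idl].
- case: q => z f ef; have [y [i iI]] := esur z; have [j [ji ij]] := iI.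
  have [g gE] := full _ _ (comp j f).
  have eg : extremal g.
    by apply/fmap_extremal; rewrite gE; apply: extremal_iso => //; exists i.
  exists (ExtremalQuotient eg), i; split=> //=.
  by rewrite gE comp_assoc ij comp_idl.
- move=> p q p' q' [i [iI iE]] [k [kI kE]]; have [j [ji ij]] := iI.
  have [l [lk kl]] := kI.
  split=> [[h hE]|[h hE]].
    exists (comp k (comp (fmap F h) j)).
    by rewrite -iE -kE -hE fmap_comp -!comp_assoc (comp_assoc j) ji comp_idl.
  have [g gE] := full _ _ (comp l (comp h i)).
  exists g; apply: faith; rewrite fmap_comp gE -!comp_assoc iE hE -kE.
  by rewrite comp_assoc lk comp_idl.
Qed.

End WeakEquivalence.

(** * Surjective homomorphisms are the extremal quotients of a quasivariety *)

Lemma sval_injective (T : Type) (P : T -> Prop) : injective (@sval T P).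
Proof. by move=> [x Px] [y Py] /= xy; exact: eq_exist. Qed.

Definition surjective_hom (S : signature) (A B : algebra S)
    (h : hom A B) : Prop :=
  forall y, exists x, h x = y.

Definition kernel (S : signature) (A B : algebra S) (h : hom A B) :
  congruence A.
Proof.
apply: (@Congruence S A (fun x y => h x = h y)) => //.
- by move=> x y z ->.
- by move=> f a b ab; rewrite !hom_interp; congr interp; apply/funext.
Defined.

Definition quot_hom (S : signature) (A : algebra S) (t : congruence A) :
    hom A (quotient t) :=
  @Hom S A (quotient t) (@quot_class S A t) (@quot_class_interp S A t).

Lemma quot_hom_surjective (S : signature) (A : algebra S) (t : congruence A) :
  surjective_hom (quot_hom t).
Proof. by move=> c; exists (quot_repr c); exact: quot_class_repr. Qed.

Lemma hom_factor (S : signature) (A B C : algebra S) (f : hom A B)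
    (g : hom A C) :
  surjective_hom f -> (forall x y, f x = f y -> g x = g y) ->
  exists h : hom B C, forall x, h (f x) = g x.
Proof.
move=> /choice[s fs] fg.
have hP (o : op S) (args : 'I_(arity o) -> B) :
    g (s (interp B o args)) = interp C o (fun i => g (s (args i))).
  rewrite -hom_interp; apply: fg; rewrite fs hom_interp; congr interp.
  by apply/funext => i; rewrite fs.
by exists (@Hom S B C (fun y => g (s y)) hP) => x; apply: fg; rewrite fs.
Qed.

Lemma hom_eval (S : signature) (X : Type) (A B : algebra S) (h : hom A B)
    (a : X -> A) (t : term S X) : h (eval a t) = eval (fun x => h (a x)) t.
Proof.
elim: t => //= f args IH; rewrite hom_interp; congr interp.
exact/funext.
Qed.

(** Quasi-equations are inherited by every algebra whose homomorphisms into the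
    quasivariety separate points, because the premises are preserved and the
    conclusion can be tested after each homomorphism.  Closure under
    isomorphism, subalgebras and products are special cases. *)
Lemma quasivariety_separated (S : signature) (K : algebra S -> Prop)
    (A : algebra S) : quasivariety K ->
  (forall x y : A, (forall B (h : hom A B), K B -> h x = h y) -> x = y) -> K A.
Proof.
move=> [Q KQ] sep; apply/KQ => q Qq a prem; apply: sep => B h /KQ KB.
by rewrite !hom_eval; apply: KB => // e /prem; rewrite -!hom_eval => ->.
Qed.

Section KernelPair.
Variables (S : signature) (A B : algebra S) (h : hom A B).

Lemma kernel_pair_interp (f : op S)
    (args : 'I_(arity f) -> {p : A * A | h p.1 = h p.2}) :
  h (interp A f (fun i => (sval (args i)).1)) =
  h (interp A f (fun i => (sval (args i)).2)).
Proof.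
rewrite !hom_interp; congr interp; apply/funext => i.
exact: (svalP (args i)).
Qed.

Lemma kernel_pair_nonempty : inhabited {p : A * A | h p.1 = h p.2}.
Proof. by case: (carrier_nonempty A) => x; exists; exists (x, x). Qed.

Definition kernel_pair : algebra S :=
  @Algebra S {p : A * A | h p.1 = h p.2}
    (fun f args => exist _ (_, _) (kernel_pair_interp args))
    kernel_pair_nonempty.

Definition kernel_fst : hom kernel_pair A :=
  @Hom S kernel_pair A (fun p => (sval p).1) (fun _ _ => erefl).

Definition kernel_snd : hom kernel_pair A :=
  @Hom S kernel_pair A (fun p => (sval p).2) (fun _ _ => erefl).

End KernelPair.

Section Image.
Variables (S : signature) (A B : algebra S) (h : hom A B).

Lemma image_interp (f : op S) (args : 'I_(arity f) -> {y | exists x, h x = y}) :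
  exists x, h x = interp B f (fun i => sval (args i)).
Proof.
have [s sP] := choice (fun i => svalP (args i)).
exists (interp A f s); rewrite hom_interp; congr interp; exact/funext.
Qed.

Lemma image_nonempty : inhabited {y | exists x, h x = y}.
Proof. by case: (carrier_nonempty A) => x; exists; exists (h x), x. Qed.

Definition image_algebra : algebra S :=
  @Algebra S {y | exists x, h x = y}
    (fun f args => exist _ _ (image_interp args)) image_nonempty.

Definition image_incl : hom image_algebra B :=
  @Hom S image_algebra B sval (fun _ _ => erefl).

Lemma image_corestrict_interp (f : op S) (args : 'I_(arity f) -> A) :
  exist _ (h (interp A f args)) (ex_intro _ _ erefl) =
  interp image_algebra f
    (fun i => exist _ (h (args i)) (ex_intro _ _ erefl)).
Proof. by apply: eq_exist => /=; rewrite hom_interp. Qed.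

Definition image_corestrict : hom A image_algebra :=
  @Hom S A image_algebra (fun x => exist _ (h x) (ex_intro _ x erefl))
    image_corestrict_interp.

End Image.

Section Quasivariety.
Variables (S : signature) (K : algebra S -> Prop).
Hypothesis quasiK : quasivariety K.

(** The kernel pair of [m] belongs to the quasivariety, and [m] equalizes its
    two projections, so that these coincide. *)
Lemma mono_injective (x y : category_of K) (m : hom (sval x) (sval y)) :
  @mono (category_of K) x y m -> injective m.
Proof.
move=> mm a b ab; have KP : K (kernel_pair m).
  apply: quasivariety_separated => // p q pq; apply: sval_injective.
  rewrite [sval p]surjective_pairing [sval q]surjective_pairing.
  congr pair; first exact: (pq _ (kernel_fst m) (svalP x)).
  exact: (pq _ (kernel_snd m) (svalP x)).
suff : kernel_fst m = kernel_snd m.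
  move/(congr1 (fun g : hom (kernel_pair m) (sval x) => g (exist _ (a, b) ab))).
  exact.
apply: (mm (exist _ _ KP)); apply: hom_ext => p; exact: (svalP p).
Qed.

(** A surjection is extremal because an injection through which it factors is
    bijective; conversely an extremal morphism factors through the inclusion of
    its image, which belongs to the quasivariety. *)
Lemma extremal_surjective (x y : category_of K) (f : hom (sval x) (sval y)) :
  @extremal (category_of K) x y f <-> surjective_hom f.
Proof.
split=> [ef b|sf z g m mm mg].
  have KI : K (image_algebra f).
    apply: quasivariety_separated => // p q pq; apply: sval_injective.
    exact: (pq _ (image_incl f) (svalP y)).
  have [] := ef (exist _ _ KI) (image_corestrict f) (image_incl f).
  - move=> z g h gh; apply: hom_ext => c; apply: sval_injective.
    exact: (congr1 (fun k : hom (sval z) (sval y) => k c) gh).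
  - exact: hom_ext.
  move=> k [_ kE]; have [a fa] := svalP ((k : hom _ (image_algebra f)) b).
  exists a; rewrite fa.
  exact: (congr1 (fun k : hom (sval y) (sval y) => k b) kE).
have mgE a : (m : hom _ _) ((g : hom _ _) a) = f a by rewrite -mg.
have sm : surjective_hom (m : hom (sval z) (sval y)).
  by move=> b; have [a <-] := sf b; exists ((g : hom _ _) a).
have [k kE] := hom_factor (g := hom_id (sval z)) sm (mono_injective mm).
exists k; split; apply: hom_ext => // b /=.
by have [c <-] := sm b; rewrite kE.
Qed.

End Quasivariety.

(** * Filters and quotients *)

Definition filters (S : signature) (V : variables) (D : deductive_system S V)
    (A : algebra S) : Type := {F : set A | is_filter D F}.

Definition filter_le (S : signature) (V : variables) (D : deductive_system S V)
    (A : algebra S) (F G : filters D A) : Prop := sval F `<=` sval G.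

(** The relative congruences of [A] are the kernels of the composites of [q]
    with extremal quotients of [A0].  Allowing [A] to lie outside [K] covers the
    formula algebra, whose reflection into [K] is the free algebra. *)
Lemma filter_quotient_equiv (S : signature) (V : variables)
    (K : algebra S -> Prop) (D : deductive_system S V) (A : algebra S)
    (A0 : category_of K) (q : hom A (sval A0)) :
  quasivariety K -> algebraizes K D -> surjective_hom q ->
  (forall t : congruence A, is_K_congruence K t -> cong_le (kernel q) t) ->
  order_equiv (@filter_le S V D A) (@quotient_le (category_of K) A0)
    (fun F p => forall x y, Leibniz (sval F) x y <->
       (quotient_mor p : hom _ _) (q x) = (quotient_mor p : hom _ _) (q y)).
Proof.
move=> quasiK algK sq leastq; have [[KL _ onto] mon] := algK A.
split=> [[F FF]|p|[F FF] [G GG] p p' /= Fp Gp'].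
- have KF : K (quotient (Leibniz F)) by exact: (KL _ FF).
  have [x y /(leastq _ KF)|h hE] := hom_factor (g := quot_hom (Leibniz F)) sq.
    by move/quot_class_eq.
  have eh : @extremal (category_of K) A0 (exist _ _ KF) h.
    apply/extremal_surjective => // c.
    by have [a <-] := quot_hom_surjective c; exists (q a).
  exists (ExtremalQuotient eh) => x y /=; rewrite !hE.
  by symmetry; exact: quot_class_eq.
- pose t := kernel (hom_comp (quotient_mor p : hom _ _) q).
  have Kt : is_K_congruence K t.
    apply: quasivariety_separated => // c d cd.
    rewrite -[c]quot_class_repr -[d]quot_class_repr; apply/quot_class_eq.
    have [h hE] := hom_factor (@quot_hom_surjective _ _ t)
                     (fun x y => proj1 (quot_class_eq t x y)).
    rewrite /t /= -[LHS]hE -[RHS]hE /= !quot_class_repr.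
    exact: (cd _ h (svalP (quotient_target p))).
  have [F FF Ft] := onto _ Kt; exists (exist _ F FF) => x y /=.
  by rewrite Ft.
- rewrite /filter_le /= mon //; split=> [FG|[h hE] x y /Fp Fxy].
    have sp : surjective_hom (quotient_mor p : hom _ _).
      exact/extremal_surjective/quotient_extremal.
    have [b c bc|h hE] := hom_factor (g := quotient_mor p' : hom _ _) sp.
      have [[x xb] [y yc]] := (sq b, sq c).
      by move: bc; rewrite -xb -yc => /Fp/FG/Gp'.
    by exists h; apply: hom_ext.
  by apply/Gp'; rewrite -hE /= Fxy.
Qed.

(** * Terms and homomorphisms from the formula algebra *)

Lemma finite_enum (T : Type) (t : T) (X : set T) : finite_set X ->
  exists n (f : nat -> T), X = f @` `I_n.
Proof.
elim/Pchoice: T => T in t X *; case/finite_seqP => s ->.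
exists (size s), (nth t s); apply/seteqP; split=> [x /= xs|_ [i /= si <-]].
  by exists (index x s); rewrite /= ?index_mem ?nth_index.
exact: mem_nth.
Qed.

Lemma vseq_bounded (V : variables) (W : set V) : finite_set W ->
  exists N, forall i, W (vseq V i) -> i < N.
Proof.
case/(finite_enum (vseq V 0)) => n [f ->]; elim: n => [|n [N NP]].
  by exists 0 => i [].
have [[i0 fi0]|nof] := pselect (exists i0, f n = vseq V i0).
  exists (maxn N i0.+1) => i [j /= jn ji].
  rewrite leq_max; move: jn; rewrite ltnS leq_eqVlt => /orP[/eqP jn|jn].
    by apply/orP; right; rewrite ltnS -(@vseq_inj V i i0) // -fi0 -jn ji.
  by rewrite (NP i) //; exists j.
exists N => i [j /= jn ji]; apply: NP; exists j => //=.
move: jn; rewrite ltnS leq_eqVlt => /orP[/eqP jn|//].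
by case: nof; exists i; rewrite -jn.
Qed.

Section Formulas.
Variables (S : signature) (V : variables).
Implicit Types (t : term S V) (A : algebra S).

Definition seqvars n : set (term S V) := [set Var (vseq V i) | i in `I_n].

Definition hom_of A (a : V -> A) : hom (Fm S V) A :=
  @Hom S (Fm S V) A (eval a) (fun _ _ => erefl).

Lemma hom_agree A (g h : hom (Fm S V) A) t :
  (forall x, term_vars t x -> g (Var x) = h (Var x)) -> g t = h t.
Proof.
elim: t => [x /(_ x)|f args IH gh]; first exact.
rewrite (hom_interp g (f := f)) (hom_interp h (f := f)).
congr interp; apply/funext => i; apply: IH => x xi.
by apply: gh; exists i.
Qed.

Lemma finite_term_vars t : finite_set (term_vars t).
Proof.
elim: t => [x|f args IH] /=; first exact: finite_set1.
by apply: bigcup_finite => // _; exact: finite_finset.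
Qed.

Lemma term_vars_eval (s : V -> term S V) t :
  term_vars (eval (A := Fm S V) s t) `<=`
  \bigcup_(x in term_vars t) term_vars (s x).
Proof.
elim: t => [x|f args IH] /= y; first by exists x.
by move=> [i _ /IH [x xi yx]]; exists x => //; exists i.
Qed.

Lemma inst_varE n (alpha : 'I_n -> term S V) (i : 'I_n) :
  inst_var alpha (vseq V i) = alpha i.
Proof.
rewrite /inst_var; case: pickP => [j /asboolP /vseq_inj /val_inj -> //|].
by move/(_ i)/asboolP.
Qed.

Lemma eval_Var t : eval (A := Fm S V) Var t = t.
Proof. by elim: t => //= f args IH; congr App; apply/funext. Qed.

Lemma inst_seqvars n (Psi : set (term S V)) :
  inst Psi (fun i : 'I_n => Var (vseq V i)) = Psi.
Proof.
rewrite /inst; suff -> : inst_var (fun i : 'I_n => Var (vseq V i)) = @Var S V.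
  by apply/seteqP; split=> [_ [t Pt <-]|t Pt];
    [rewrite eval_Var|exists t; rewrite ?eval_Var].
by apply: funext => x; rewrite /inst_var; case: pickP => // i /asboolP ->.
Qed.

Lemma range_seqvars n : range (fun i : 'I_n => Var (vseq V i)) = seqvars n.
Proof.
apply/seteqP; split=> [_ [i _ <-]|_ [i ni <-]]; first by exists (val i) => /=.
by exists (Ordinal ni).
Qed.

Lemma hom_agree_Fmn A (g h : hom (Fm S V) A) n
    (Psi : set (term S V)) :
  Psi `<=` @Fmn S V n ->
  (forall i, i < n -> g (Var (vseq V i)) = h (Var (vseq V i))) ->
  forall t, Psi t -> g t = h t.
Proof.
by move=> Pn gh t /Pn tn; apply: hom_agree => x /tn[i /= /gh E <-].
Qed.

Lemma finite_seqvars n : finite_set (seqvars n).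
Proof. by apply: finite_image; exact: finite_II. Qed.

Lemma finite_vseq n : finite_set (vseq V @` `I_n).
Proof. by apply: finite_image; exact: finite_II. Qed.

Lemma range_enumeration (P : {fset term S V}) :
  range (enumeration (A := P)) = [set` P].
Proof.
apply/seteqP; split=> [_ [i _ <-]|t /= Pt]; first exact: mem_tnth.
have : t \in in_tuple (enum_fset P) by [].
by case/tnthP => i ->; exists i.
Qed.

Lemma hom_of_seq A (f : nat -> A) :
  exists h : hom (Fm S V) A, forall i, h (Var (vseq V i)) = f i.
Proof.
exists (hom_of (fun x => if pselect (exists i, x = vseq V i) is left e
                         then f (projT1 (cid e)) else f 0)) => i /=.
case: pselect => [e|[]]; last by exists i.
by case: (cid e) => j /= /vseq_inj ->.
Qed.

Lemma hom_of_ord A n (a : 'I_n -> A) :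
  exists h : hom (Fm S V) A, forall i : 'I_n, h (Var (vseq V i)) = a i.
Proof.
have [c] := carrier_nonempty A.
have [h hE] := hom_of_seq (fun i => if insub i is Some j then a j else c).
by exists h => i; rewrite hE valK.
Qed.

Lemma image_seqvars A (h : hom (Fm S V) A) n (a : 'I_n -> A) :
  (forall i : 'I_n, h (Var (vseq V i)) = a i) ->
  h @` seqvars n = range a.
Proof.
by move=> ha; rewrite -range_seqvars image_comp; congr image; exact/funext.
Qed.

(** Only finitely many of the infinitely many variables are constrained, so
    the rest can be used to reach any finitely many elements. *)
Lemma hom_prescribed A (g : hom (Fm S V) A) (W : set V) (C : set A) :
  finite_set W -> finite_set C ->
  exists h : hom (Fm S V) A,
    (forall x, W x -> h (Var x) = g (Var x)) /\ C `<=` range h.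
Proof.
move=> /vseq_bounded[N NP]; have [c0] := carrier_nonempty A.
case/(finite_enum c0) => n [f ->].
pose k x := if pselect (exists i, x = vseq V (N + i)) is left e
            then f (projT1 (cid e)) else g (Var x).
exists (hom_of k); split=> [x Wx|_ [i _ <-]].
  rewrite /= /k; case: pselect => // -[i xi]; exfalso.
  by move: Wx; rewrite xi => /NP; rewrite ltnNge leq_addr.
exists (Var (vseq V (N + i))) => //=; rewrite /k; case: pselect => [e|[]].
  by case: (cid e) => j /= /vseq_inj/addnI ->.
by exists i.
Qed.

End Formulas.
Arguments seqvars : clear implicits.

(** * Generation of filters *)

Section Filters.
Variables (S : signature) (V : variables) (D : deductive_system S V).
Implicit Types (A : algebra S).

Definition generated A (X : set A) : set A :=
  [set a | forall F : set A, is_filter D F -> X `<=` F -> F a].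

Lemma generated_filter A (X : set A) : is_filter D (generated X).
Proof.
move=> Gamma alpha Ga h hG F FF XF; apply: (FF _ _ Ga) => a /hG; exact.
Qed.

Definition filter_gen A (X : set A) : filters D A :=
  exist _ (generated X) (generated_filter (X := X)).

Lemma sub_generated A (X : set A) : X `<=` generated X.
Proof. by move=> a Xa F _; exact. Qed.

Lemma filter_gen_le A (X : set A) (F : filters D A) :
  filter_le (filter_gen X) F <-> X `<=` sval F.
Proof.
split=> [XF a Xa|XF a]; first exact: (XF _ (sub_generated Xa)).
by apply; first exact: (svalP F).
Qed.

Lemma total_filter A : is_filter D [set: A].
Proof. by []. Qed.

Lemma cover_filters A (F G : filters D A) :
  (forall E, below_join (@filter_le _ _ D A) E F G) <->
  forall Z, is_filter D Z -> sval F `<=` Z -> sval G `<=` Z -> Z = setT.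
Proof.
split=> [top Z ZF FZ GZ|top E Z FZ GZ]; last first.
  by rewrite /filter_le (top _ (svalP Z)).
apply/seteqP; split=> // a _.
exact: (top (exist _ _ (@total_filter A)) (exist _ Z ZF)).
Qed.

Lemma theory_filter Gamma : is_filter D (A := Fm S V) (D Gamma).
Proof.
move=> Pi alpha /derives_subst Pa h hP.
by apply: (derives_trans (Pi := h @` Pi)) (Pa h).
Qed.

Lemma filter_theory (F : set (term S V)) alpha :
  is_filter D (A := Fm S V) F -> D F alpha -> F alpha.
Proof. by move=> FF Fa; apply: (FF _ _ Fa (hom_id _)) => _ [a Fa' <-]. Qed.

Lemma theory_min (Gamma F : set (term S V)) :
  is_filter D (A := Fm S V) F -> Gamma `<=` F -> D Gamma `<=` F.
Proof.
move=> FF GF alpha Ga; apply: filter_theory => //.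
by apply: derives_trans Ga => beta /GF; exact: derives_refl.
Qed.

Lemma derives_mono (Gamma Pi : set (term S V)) :
  Gamma `<=` Pi -> D Gamma `<=` D Pi.
Proof.
by move=> GP a; apply: derives_trans => b /GP; exact: derives_refl.
Qed.

Lemma preimage_filter A B (h : hom A B) (F : set B) :
  is_filter D F -> is_filter D (h @^-1` F).
Proof.
move=> FF Gamma alpha Ga g gG; apply: (FF _ _ Ga (hom_comp h g)).
by move=> _ [b Gb <-]; apply: gG; exists b.
Qed.

Lemma directed_finite A (Q : filters D A -> Prop) (X : set A) :
  directed (@filter_le _ _ D A) Q -> finite_set X ->
  (forall a, X a -> exists2 F, Q F & sval F a) ->
  exists2 F, Q F & X `<=` sval F.
Proof.
have [c0] := carrier_nonempty A.
move=> [[F0 QF0] dirQ] /(finite_enum c0)[n [f ->]]; elim: n => [|n IH] XQ.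
  by exists F0 => // a [].
have [a [i /= ni <-]|F QF XF] := IH.
  by apply: XQ; exists i => //=; apply: leq_trans ni _.
have [|G QG Gf] := XQ (f n); first by exists n => /=.
have [E [QE FE GE]] := dirQ _ _ QF QG; exists E => // _ [i /= ni <-].
move: ni; rewrite ltnS leq_eqVlt => /orP[/eqP ->|ni]; first exact: GE.
by apply/FE/XF; exists i.
Qed.

(** Directed unions of filters are filters by finitarity, so the compact
    filters are the finitely generated ones. *)
Lemma compact_filter A (F : filters D A) :
  compact (@filter_le _ _ D A) F <->
  exists X, finite_set X /\ sval F = generated X.
Proof.
split=> [cF|[X [finX FX]] Q E dirQ [ubE lubE] FE].
  have [|||G [X [finX XF] ->] FX] :=
    cF (fun G => exists2 X, finite_set X /\ X `<=` sval F & G = filter_gen X) F.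
  - split.
      exists (filter_gen set0), set0 => //.
      by split; [exact: finite_set0|exact: sub0set].
    move=> _ _ [X [fX XF] ->] [Y [fY YF] ->]; exists (filter_gen (X `|` Y)).
    split; last 2 first.
    + by apply/filter_gen_le => a Xa; apply: sub_generated; left.
    + by apply/filter_gen_le => a Ya; apply: sub_generated; right.
    exists (X `|` Y) => //; split; first by rewrite finite_setU.
    by move=> a [/XF|/YF].
  - split=> [_ [X [_ XF] ->]|U ubU a Fa]; first exact/filter_gen_le.
    apply: (ubU (filter_gen [set a])); last exact: sub_generated.
    by exists [set a] => //; split; [exact: finite_set1|move=> _ ->].
  - by [].
  exists X; split=> //; apply/seteqP; split=> //; exact/filter_gen_le.
pose U : set A := [set a | exists2 G, Q G & sval G a].
have UF : is_filter D U.
  move=> Gamma alpha /derives_finitary[Pi [finP PG Pa]] h hG.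
  have [||G QG GP] := directed_finite (X := h @` Pi) dirQ.
  - exact: finite_image.
  - by move=> _ [b Pb <-]; apply: hG; exists b => //; exact: PG.
  by exists G => //; exact: (svalP G _ _ Pa).
have EU : sval E `<=` U.
  by apply: (lubE (exist _ U UF)) => G QG a Ga; exists G.
have [|G QG XG] := directed_finite (X := X) dirQ finX.
  by move=> a Xa; apply/EU/FE; rewrite FX; exact: sub_generated.
by exists G => //; rewrite /filter_le FX => a; apply; first exact: (svalP G).
Qed.

(** Substitution invariance makes the absurdity of a finite set inherited by
    every algebra: a variable that does not occur in the set can be sent to an
    arbitrary element. *)
Lemma inconsistent_total A (h : hom (Fm S V) A) (Xi : set (term S V))
    (Z : set A) :
  finite_set Xi -> inconsistent D Xi -> is_filter D Z -> h @` Xi `<=` Z ->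
  Z = setT.
Proof.
move=> finX incX ZF hX; apply/seteqP; split=> // c _.
have [|N NP] := @vseq_bounded V (\bigcup_(t in Xi) term_vars t).
  by apply: bigcup_finite => // t _; exact: finite_term_vars.
pose k x := if `[< x = vseq V N >] then c else h (Var x).
have := ZF _ _ (incX (Var (vseq V N))) (hom_of k).
rewrite /= /k asboolT //; apply=> _ [t Xt <-]; apply: hX.
exists t => //; apply: (hom_agree (h := hom_of k)) => x tx /=.
rewrite /k asboolF // => xN; suff: N < N by rewrite ltnn.
by apply: NP; exists t; rewrite -?xN.
Qed.

(** * Lifting derivations from an algebra to formulas *)

Section Lifting.
Variable K : algebra S -> Prop.
Hypothesis algK : algebraizes K D.

(** The kernel of [h] is compatible with the preimage of [F], hence contained
    in its Leibniz congruence, and monotonicity of the Leibniz operator carries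
    this up to [T]. *)
Lemma theory_saturated A (h : hom (Fm S V) A) (F : set A) (T : set (term S V))
    alpha beta :
  is_filter D F -> is_filter D (A := Fm S V) T -> h @^-1` F `<=` T ->
  h alpha = h beta -> T alpha -> T beta.
Proof.
move=> FF TF FT hab; have [compT _] := LeibnizP (A := Fm S V) T.
apply: compT; have [_ mon] := algK (Fm S V).
apply: (proj1 (mon _ _ (preimage_filter FF) TF) FT).
have [_] := LeibnizP (A := Fm S V) (h @^-1` F).
apply; last exact: (hab : kernel h _ _).
by move=> x y /= hxy; rewrite /preimage /= hxy.
Qed.

(** Elements whose membership in the filter generated by [F] and [X] is
    witnessed by derivations between preimages, provided that the range of the
    homomorphism contains the finitely many elements met on the way. *)
Definition lifted A (F X : set A) : set A :=
  [set a | exists C, finite_set C /\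
    forall h : hom (Fm S V) A, C `<=` range h ->
    forall Xi, X `<=` h @` Xi ->
    forall alpha, h alpha = a -> D (h @^-1` F `|` Xi) alpha].

Lemma lifted_filter A (F X : set A) :
  is_filter D F -> is_filter D (lifted F X).
Proof.
move=> FF Gamma gamma /derives_finitary[Pi [finP PG Pg]] g gG.
have /choice[c cP] : forall d, exists C, Pi d -> finite_set C /\
    forall h : hom (Fm S V) A, C `<=` range h ->
    forall Xi, X `<=` h @` Xi ->
    forall alpha, h alpha = g d -> D (h @^-1` F `|` Xi) alpha.
  move=> d; have [Pd|] := pselect (Pi d); last by exists set0.
  by have [|C CP] := gG (g d); [exists d => //; exact: PG|exists C].
pose W := \bigcup_(d in Pi `|` [set gamma]) term_vars d.
exists (\bigcup_(d in Pi) c d `|` [set g (Var x) | x in W]); split.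
  rewrite finite_setU; split; first by apply: bigcup_finite => // d /cP[].
  apply: finite_image; apply: bigcup_finite => [|d _].
    by rewrite finite_setU; split=> //; exact: finite_set1.
  exact: finite_term_vars.
move=> h hC Xi hX alpha ha.
have /choice[s sP] : forall x, exists t, W x -> h t = g (Var x).
  move=> x; have [Wx|] := pselect (W x); last by exists (Var x).
  by have [|t _ ht] := hC (g (Var x)); [right; exists x|exists t].
have hs d : (Pi `|` [set gamma]) d -> h (hom_of (A := Fm S V) s d) = g d.
  move=> Pd; apply: (hom_agree (g := hom_comp h (hom_of (A := Fm S V) s))).
  by move=> x dx; apply: sP; exists d.
apply: (theory_saturated (h := h) (alpha := hom_of (A := Fm S V) s gamma) FF
          (theory_filter (Gamma := h @^-1` F `|` Xi))).
- by move=> b Fb; apply: derives_refl; left.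
- by rewrite ha hs //; right.
apply: (derives_trans (Pi := hom_of (A := Fm S V) s @` Pi));
  last exact: derives_subst.
move=> _ [d Pd <-]; have [_] := cP d Pd; apply=> //; last by apply: hs; left.
by move=> b cb; apply: hC; left; exists d.
Qed.

Lemma sub_lifted A (F X : set A) : is_filter D F -> F `|` X `<=` lifted F X.
Proof.
move=> FF a [Fa|Xa]; exists set0; split=> // h _ Xi hX alpha ha.
  by apply: derives_refl; left; rewrite /preimage /= ha.
have [xi Xxi hxi] := hX _ Xa.
apply: (theory_saturated (h := h) (alpha := xi) FF
          (theory_filter (Gamma := h @^-1` F `|` Xi))).
- by move=> b Fb; apply: derives_refl; left.
- by rewrite hxi.
- by apply: derives_refl; right.
Qed.

Lemma generated_lifted A (F X : set A) : is_filter D F ->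
  generated (F `|` X) `<=` lifted F X.
Proof.
by move=> FF a; apply; [exact: lifted_filter|exact: sub_lifted].
Qed.

Lemma inconsistent_lift A (F X : set A) (Xi0 : set (term S V)) :
  finite_set Xi0 -> inconsistent D Xi0 -> is_filter D F ->
  generated (F `|` X) = setT ->
  exists C, finite_set C /\
    forall h : hom (Fm S V) A, C `<=` range h ->
    forall Xi, X `<=` h @` Xi -> inconsistent D (h @^-1` F `|` Xi).
Proof.
move=> fin0 inc0 FF top; have [a0] := carrier_nonempty A.
have /choice[c cP] a : lifted F X a by apply: generated_lifted; rewrite // top.
pose g := hom_of (fun _ : V => a0).
exists (a0 |` \bigcup_(xi in Xi0) c (g xi)); split.
  rewrite finite_setU; split; first exact: finite_set1.
  by apply: bigcup_finite => // xi _; have [] := cP (g xi).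
move=> h hC Xi hX alpha; have [|t _ ta] := hC a0; first by left.
pose s := hom_of (A := Fm S V) (fun _ : V => t).
have -> : D (h @^-1` F `|` Xi) = setT; last by [].
apply: (inconsistent_total (h := s) fin0 inc0); first exact: theory_filter.
move=> _ [xi Xxi <-]; have [_] := cP (g xi); apply=> //.
  by move=> b cb; apply: hC; right; exists xi.
by apply: (hom_agree (g := hom_comp h s)) => x _ /=.
Qed.

(** Otherwise the empty and the total filter would both be filters with total
    Leibniz congruence. *)
Lemma filter_nonempty A (F : set A) : is_filter D F -> F !=set0.
Proof.
move=> FF; apply/set0P/eqP => F0.
have [_ mon] := algK A; have [a] := carrier_nonempty A.
have : [set: A] `<=` F.
  apply/(mon _ _ (@total_filter A) FF) => x y _.
  have [t tT] : exists t : congruence A, forall u v, t u v.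
    by unshelve eexists (@Congruence S A (fun _ _ => True) _ _ _ _).
  by have [_ /(_ t)] := LeibnizP F; apply=> [u v _|//]; rewrite F0.
by rewrite F0 => /(_ a); apply.
Qed.

End Lifting.
End Filters.

(** * From a weak excluded middle law to dually Stone filter lattices *)

Section FilterLattice.
Variables (S : signature) (V : variables) (D : deductive_system S V).
Variable K : algebra S -> Prop.
Hypothesis algK : algebraizes K D.

Section ILSequence.
Variable Psi : nat -> {fset term S V}.
Hypothesis ilPsi : elementary_IL_sequence D Psi.

Lemma IL_inconsistent n : 0 < n ->
  inconsistent D ([set` Psi n] `|` seqvars S V n).
Proof.
move=> n0; have [_ il] := ilPsi n0; rewrite -range_seqvars; apply/il.
by rewrite inst_seqvars => t; exact: derives_refl.
Qed.

(** The total filter is generated by a finite set, so that its generation from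
    [G] and the values of the variables already takes place at the level of
    formulas, where the inconsistency lemma is available. *)
Lemma IL_filter (A : algebra S) (h : hom (Fm S V) A) n (G : set A) :
  0 < n -> is_filter D G ->
  (forall Z, is_filter D Z -> G `<=` Z -> h @` seqvars S V n `<=` Z -> Z = setT)
  <-> h @` [set` Psi n] `<=` G.
Proof.
move=> n0 GF; have [Pn il] := ilPsi n0.
have finI : finite_set ([set` Psi n] `|` seqvars S V n).
  by rewrite finite_setU; split; [exact: finite_fset|exact: finite_seqvars].
split=> [top|hPG Z ZF GZ hZ]; last first.
  apply: (inconsistent_total (h := h) finI (IL_inconsistent n0) ZF).
  by move=> _ [t [Pt|vt] <-]; [apply/GZ/hPG; exists t|apply: hZ; exists t].
have [|C [finC CP]] := inconsistent_lift algK (F := G)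
    (X := h @` seqvars S V n) finI (IL_inconsistent n0) GF.
  apply: top; first exact: generated_filter.
    by move=> a Ga; apply: sub_generated; left.
  by move=> a ha; apply: sub_generated; right.
have [g [gh Cg]] := hom_prescribed h (finite_vseq V n) finC.
have gh' i : i < n -> g (Var (vseq V i)) = h (Var (vseq V i)).
  by move=> ni; apply: gh; exists i.
have /(_ _) inc := CP g Cg (seqvars S V n) _.
have : inconsistent D (g @^-1` G `|` range (fun i : 'I_n => Var (vseq V i))).
  rewrite range_seqvars; apply: inc => _ [_ [i /= ni <-] <-].
  by exists (Var (vseq V i)); [exists i|exact: gh'].
move/il; rewrite inst_seqvars => dG _ [t Pt <-].
rewrite -(hom_agree_Fmn Pn gh' Pt).
exact: (filter_theory (preimage_filter GF) (dG _ Pt)).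
Qed.

Lemma IL_dual_pc (A : algebra S) (h : hom (Fm S V) A) n : 0 < n ->
  dual_pc (@filter_le _ _ D A) (filter_gen D (h @` seqvars S V n))
    (filter_gen D (h @` [set` Psi n])).
Proof.
move=> n0 F; rewrite cover_filters filter_gen_le -(IL_filter h n0 (svalP F)).
split=> top Z ZF FZ hZ; apply: top => //.
  by move=> a; apply.
by move=> a ha; apply: hZ; exact: sub_generated.
Qed.

End ILSequence.

Lemma dual_pc_unique (A : algebra S) (F G H : filters D A) :
  dual_pc (@filter_le _ _ D A) F G -> dual_pc (@filter_le _ _ D A) F H -> G = H.
Proof.
move=> FG FH; apply: sval_injective; apply/seteqP; split.
  by apply/FG/FH => a.
by apply/FH/FG => a.
Qed.

(** The finitely many generators can be taken as the values of [v_1, ..., v_n]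
    with [n] positive, for filters are nonempty. *)
Lemma compact_seqvars (A : algebra S) (F : filters D A) :
  compact (@filter_le _ _ D A) F -> exists n (h : hom (Fm S V) A),
    0 < n /\ F = filter_gen D (h @` seqvars S V n).
Proof.
move=> /compact_filter[X [finX FX]].
have [c Fc] := filter_nonempty algK (svalP F).
have [n [f XE]] := finite_enum c finX.
have [h hP] := hom_of_seq V (fun i => if i < n then f i else c).
exists n.+1, h; split=> //; apply: sval_injective => /=.
apply/seteqP; split=> a.
  rewrite FX; apply; first exact: generated_filter.
  rewrite XE => _ [i /= ni <-]; apply: sub_generated.
  exists (Var (vseq V i)); last by rewrite hP ni.
  by exists i => //=; exact: ltnW.
apply; first exact: svalP.
move=> _ [_ [i /= ni <-] <-]; rewrite hP; case: ifP => // {}ni.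
by rewrite FX; apply: sub_generated; rewrite XE; exists i.
Qed.

(** A homomorphism whose range contains the witnesses of both memberships turns
    them into derivations from the same preimage of [F], where the law for
    formulas applies. *)
Lemma WEML_filter (Psi : nat -> {fset term S V}) (A : algebra S)
    (h0 h1 : hom (Fm S V) A) n (F : set A) :
  elementary_IL_sequence D Psi ->
  (forall phi Gamma, D (Gamma `|` [set` Psi n]) phi ->
     D (Gamma `|` Psi_Psi Psi n) phi -> D Gamma phi) ->
  0 < n -> 0 < #|` Psi n| -> is_filter D F ->
  (forall j : 'I_#|` Psi n|, h1 (Var (vseq V j)) = h0 (enumeration j)) ->
  forall a, generated D (F `|` h0 @` [set` Psi n]) a ->
    generated D (F `|` h1 @` [set` Psi #|` Psi n|]) a -> F a.
Proof.
move=> il weml n0 m0 FF h10 a.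
move=> /(generated_lifted algK FF)[C0 [fin0 C0P]].
move=> /(generated_lifted algK FF)[C1 [fin1 C1P]].
have [|g [gh Cg]] := hom_prescribed (C := a |` (C0 `|` C1))
    h0 (finite_vseq V n).
  by rewrite !finite_setU; split=> //; exact: finite_set1.
have [Pn _] := il n n0; have [Pm _] := il _ m0.
have gh' i : i < n -> g (Var (vseq V i)) = h0 (Var (vseq V i)).
  by move=> ni; apply: gh; exists i.
have [|t _ ta] := Cg a; first by left.
rewrite -ta; apply: (filter_theory (preimage_filter FF) (alpha := t)).
apply: weml.
  apply: C0P => // [b Cb|_ [s Ps <-]]; first by apply: Cg; right; left.
  by exists s => //; exact: (hom_agree_Fmn Pn gh').
apply: C1P => // [b Cb|_ [s Ps <-]]; first by apply: Cg; right; right.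
pose e := hom_of (A := Fm S V) (inst_var (enumeration (A := Psi n))).
exists (e s); first by exists s.
apply: (hom_agree_Fmn (g := hom_comp g e) Pm _ Ps) => j mj.
rewrite /= (inst_varE _ (Ordinal mj)) (h10 (Ordinal mj)).
apply: (hom_agree_Fmn Pn gh').
exact: mem_tnth.
Qed.

Lemma WEML_dually_stone : has_WEML D ->
  forall A : algebra S, dually_stone (@filter_le S V D A).
Proof.
move=> [Psi [il weml]] A; split=> [F|F G H cF FG GH X Y].
  move=> /compact_seqvars[n [h [n0 ->]]].
  exists (filter_gen D (h @` [set` Psi n])); last exact: IL_dual_pc.
  apply/compact_filter; exists (h @` [set` Psi n]); split=> //.
  by apply: finite_image; exact: finite_fset.
have [n [h0 [n0 FE]]] := compact_seqvars cF.
have GE : G = filter_gen D (h0 @` [set` Psi n]).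
  by apply: dual_pc_unique FG _; rewrite FE; exact: IL_dual_pc.
have [m0|] := posnP #|` Psi n|.
  move=> YG _; apply: YG => // a; rewrite GE.
  apply=> [|b [t + _]]; first exact: svalP.
  by rewrite /= (cardfs0_eq m0).
move=> m0.
have [h1 h1P] := hom_of_ord V (fun j => h0 (enumeration (A := Psi n) j)).
have HE : H = filter_gen D (h1 @` [set` Psi #|` Psi n|]).
  apply: dual_pc_unique GH _.
  have -> : G = filter_gen D (h1 @` seqvars S V #|` Psi n|).
    rewrite GE; congr filter_gen.
    by rewrite (image_seqvars h1P) -range_enumeration image_comp.
  exact: IL_dual_pc.
move=> YG YH a Ya.
apply: (WEML_filter il _ n0 m0 (svalP X) h1P).
- move=> phi Gamma; have := weml n n0 Gamma (fun i => Var (vseq V i)) phi.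
  by rewrite !inst_seqvars.
- apply: (YG (filter_gen D (sval X `|` h0 @` [set` Psi n]))) => //.
    by move=> b Xb; apply: sub_generated; left.
  rewrite GE; apply/filter_gen_le => b hb; apply: sub_generated; by right.
- apply: (YH (filter_gen D (sval X `|` h1 @` [set` Psi #|` Psi n|]))) => //.
    by move=> b Xb; apply: sub_generated; left.
  rewrite HE; apply/filter_gen_le => b hb; apply: sub_generated; by right.
Qed.

(** * Back to a weak excluded middle law *)

Definition theory (Gamma : set (term S V)) : filters D (Fm S V) :=
  exist _ (D Gamma) (theory_filter (Gamma := Gamma)).

Lemma theory_le (Gamma : set (term S V)) (F : filters D (Fm S V)) :
  filter_le (theory Gamma) F <-> Gamma `<=` sval F.
Proof.
split=> [GF a Ga|]; first exact/GF/derives_refl.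
by apply: theory_min; exact: svalP.
Qed.

Lemma generated_theory (Gamma : set (term S V)) :
  generated D (A := Fm S V) Gamma = D Gamma.
Proof.
apply/seteqP; split=> a.
  by apply; [exact: theory_filter|move=> b; exact: derives_refl].
by move=> Ga F FF GF; exact: (theory_min FF GF).
Qed.

Lemma compact_theory (F : filters D (Fm S V)) :
  compact (@filter_le _ _ D (Fm S V)) F <->
  exists X, finite_set X /\ F = theory X.
Proof.
rewrite compact_filter; split=> -[X [finX FX]]; exists X; split=> //.
  by apply: sval_injective; rewrite FX generated_theory.
by rewrite FX generated_theory.
Qed.

Lemma cover_theories (X Y : set (term S V)) :
  (forall E, below_join (@filter_le _ _ D (Fm S V)) E (theory X) (theory Y)) <->
  inconsistent D (X `|` Y).
Proof.
rewrite cover_filters; split=> [top a|inc Z ZF XZ YZ].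
  rewrite (top (D (X `|` Y))) //; first exact: theory_filter.
    by apply: derives_mono => b; left.
  by apply: derives_mono => b; right.
apply/seteqP; split=> // a _; apply: (theory_min ZF _ (inc a)) => b [Xb|Yb].
  exact/XZ/derives_refl.
exact/YZ/derives_refl.
Qed.

Hypothesis stoneD : dually_stone (@filter_le S V D (Fm S V)).

(** The dual pseudo-complement of the bottom is the top, which is therefore
    compact. *)
Lemma finite_inconsistent : exists Xi, finite_set Xi /\ inconsistent D Xi.
Proof.
have [|b /compact_theory[Xi [finX ->]] /(_ (theory Xi))[_ top]] :=
  stoneD.1 (theory set0).
  by apply/compact_theory; exists set0.
exists Xi; split=> //; rewrite -[Xi]setU0; apply/cover_theories/top.
by move=> a.
Qed.

Lemma finite_dual_pc n : exists Phi, finite_set Phi /\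
  dual_pc (@filter_le S V D (Fm S V)) (theory (seqvars S V n)) (theory Phi).
Proof.
have [|b /compact_theory[Phi [finP ->]] pc] :=
  stoneD.1 (theory (seqvars S V n)).
  apply/compact_theory; exists (seqvars S V n); split=> //.
  exact: finite_seqvars.
by exists Phi.
Qed.

Definition collapse n : hom (Fm S V) (Fm S V) :=
  hom_of (A := Fm S V) (fun x =>
    if `[< (vseq V @` `I_n) x >] then Var x else Var (vseq V 0)).

Lemma collapse_seqvar n i : i < n ->
  collapse n (Var (vseq V i)) = Var (vseq V i).
Proof. by move=> ni /=; rewrite asboolT //; exists i. Qed.

Lemma collapse_Fmn n t : 0 < n -> @Fmn S V n (collapse n t).
Proof.
move=> n0 x /term_vars_eval[y _]; case: ifP => [/asboolP yn -> //|_ ->].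
by exists 0.
Qed.

(** A finite set that generates the dual pseudo-complement may contain variables
    other than [v_1, ..., v_n].  Collapsing them is harmless: the homomorphism
    along which inconsistency is lifted may be prescribed on them as well. *)
Lemma collapse_IL n (Phi : set (term S V)) : 0 < n -> finite_set Phi ->
  dual_pc (@filter_le S V D (Fm S V)) (theory (seqvars S V n)) (theory Phi) ->
  forall (Gamma : set (term S V)) (alpha : 'I_n -> term S V),
    inconsistent D (Gamma `|` range alpha) <->
    derives_all D Gamma (inst (collapse n @` Phi) alpha).
Proof.
move=> n0 finP pc Gamma alpha.
pose h := hom_comp (hom_of (A := Fm S V) (inst_var alpha)) (collapse n).
have hv (i : 'I_n) : h (Var (vseq V i)) = alpha i.
  by rewrite -[LHS]/(eval _ (collapse n _)) collapse_seqvar //= inst_varE.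
have -> : inst (collapse n @` Phi) alpha = h @` Phi.
  by rewrite /inst image_comp.
split=> [inc|dG].
  have [Xi0 [fin0 inc0]] := finite_inconsistent.
  have [||C [finC CP]] := inconsistent_lift algK (A := Fm S V) (F := D Gamma)
      (X := range alpha) fin0 inc0.
  - exact: theory_filter.
  - rewrite generated_theory; apply/seteqP; split=> // a _.
    apply: (derives_mono _ (inc a)) => b [Gb|]; last by right.
    by left; exact: derives_refl.
  (* [g] agrees with [h] on the variables of [Phi] and yet reaches [C]. *)
  have [|g [gh Cg]] := hom_prescribed (C := C)
      (W := vseq V @` `I_n `|` \bigcup_(t in Phi) term_vars t) h _ finC.
    rewrite finite_setU; split; first exact: finite_vseq.
    by apply: bigcup_finite => // t _; exact: finite_term_vars.
  have GF : is_filter D (g @^-1` D Gamma).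
    by apply: preimage_filter; exact: theory_filter.
  have PG : filter_le (theory Phi) (exist _ _ GF).
    apply/pc/cover_filters => Z ZF GZ vZ; apply/seteqP; split=> // a _.
    have inc1 : inconsistent D (g @^-1` D Gamma `|` seqvars S V n).
      apply: CP => // _ [i _ <-]; exists (Var (vseq V i)).
        by exists i => /=.
      by rewrite gh ?hv //; left; exists i => /=.
    apply: (theory_min ZF _ (inc1 a)) => b [/GZ //|vb].
    exact/vZ/derives_refl.
  move=> _ [t Pt <-].
  have <- : g t = h t.
    by apply: hom_agree => x tx; apply: gh; right; exists t.
  by apply: (PG t); exact: derives_refl.
have incP : inconsistent D (seqvars S V n `|` Phi).
  rewrite setUC; apply/cover_theories.
  by apply/pc => a.
have finVP : finite_set (seqvars S V n `|` Phi).
  by rewrite finite_setU; split=> //; exact: finite_seqvars.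
move=> a; have -> : D (Gamma `|` range alpha) = setT; last by [].
apply: (inconsistent_total (h := h) finVP incP); first exact: theory_filter.
move=> _ [t [[i /= ni <-]|Pt] <-].
  by apply: derives_refl; right; exists (Ordinal ni); rewrite -?hv.
apply: (derives_mono (Gamma := Gamma)); first by move=> b; left.
by apply: dG; exists t.
Qed.

Lemma dually_stone_WEML : has_WEML D.
Proof.
have /choice[Phi PhiP] := finite_dual_pc.
have finC n : finite_set (collapse n @` Phi n).
  by apply: finite_image; have [] := PhiP n.
pose Psi n := fset_set (collapse n @` Phi n).
have PsiE n : [set` Psi n] = collapse n @` Phi n by exact: fset_setK.
have il : elementary_IL_sequence D Psi.
  move=> n n0; rewrite PsiE; have [finP pc] := PhiP n.
  split=> [_ [t _ <-]|]; first exact: collapse_Fmn.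
  exact: collapse_IL.
exists Psi; split=> // n n0 Gamma alpha phi D1 D2.
(* An empty [Psi n] adds nothing to [Gamma] in the first premise. *)
have [m0|m0] := posnP #|` Psi n|.
  apply: (derives_mono _ D1) => a [//|[t + _]].
  by rewrite /= (cardfs0_eq m0).
pose h0 := hom_of (A := Fm S V) (inst_var alpha).
pose e := hom_of (A := Fm S V) (inst_var (enumeration (A := Psi n))).
pose h1 := hom_comp h0 e.
have gen (X : set (term S V)) :
    filter_gen D (A := Fm S V) X = theory X.
  by apply: sval_injective; exact: generated_theory.
have pc0 := IL_dual_pc il h0 n0; have pc1 := IL_dual_pc il h1 m0.
have E1 : h1 @` seqvars S V #|` Psi n| = h0 @` [set` Psi n].
  have h1E (j : 'I_#|` Psi n|) : h1 (Var (vseq V j)) = h0 (enumeration j).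
    by rewrite /= inst_varE.
  by rewrite (image_seqvars h1E) -range_enumeration image_comp.
rewrite E1 in pc1; rewrite !gen in pc0 pc1.
have cF : compact (@filter_le S V D (Fm S V)) (theory (h0 @` seqvars S V n)).
  apply/compact_theory; exists (h0 @` seqvars S V n); split=> //.
  by apply: finite_image; exact: finite_seqvars.
suff : filter_le (theory [set phi]) (theory Gamma) by move/theory_le; apply.
have bound (X : set (term S V)) : D (Gamma `|` X) phi ->
    below_join (@filter_le _ _ D (Fm S V))
      (theory [set phi]) (theory Gamma) (theory X).
  move=> Dphi Z /theory_le GZ /theory_le XZ; apply/theory_le => _ ->.
  by apply: (theory_min (svalP Z) _ Dphi) => a [/GZ|/XZ].
apply: (stoneD.2 _ _ _ cF pc0 pc1); apply: bound; first exact: D1.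
by rewrite -[h1 @` _](image_comp e h0).
Qed.

End FilterLattice.

(** * Invariance under categorical equivalence *)

(** The quotient by this congruence reflects [A] into the quasivariety; for the
    formula algebra it is the free algebra. *)
Lemma least_K_congruence (S : signature) (V : variables)
    (K : algebra S -> Prop) (D : deductive_system S V) (A : algebra S) :
  algebraizes K D -> exists2 t : congruence A, is_K_congruence K t &
    forall u : congruence A, is_K_congruence K u -> cong_le t u.
Proof.
move=> algK; have [[KL _ onto] mon] := algK A.
have F0 : is_filter D (generated D (set0 : set A)) := generated_filter (X := _).
exists (Leibniz (generated D (set0 : set A))); first exact: (KL _ F0).
move=> u /onto[F FF <-]; apply/mon => // a; apply=> //; exact: sub0set.
Qed.

Theorem corollary8p7 (S1 S2 : signature) (V1 V2 : variables)
  (D1 : deductive_system S1 V1) (D2 : deductive_system S2 V2)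
  (K1 : algebra S1 -> Prop) (K2 : algebra S2 -> Prop) :
  quasivariety K1 -> quasivariety K2 ->
  equivalent_categories (category_of K1) (category_of K2) ->
  algebraizes K1 D1 -> algebraizes K2 D2 ->
  has_WEML D1 -> has_WEML D2.
Proof.
move=> quasi1 quasi2 [F [G [FG GF]]] alg1 alg2 weml1.
have [H weqH] : exists H : functor (category_of K2) (category_of K1),
    weak_equivalence H.
  by apply: equivalent_weak_equivalence; exists G, F.
have [t Kt least] := least_K_congruence (Fm S2 V2) alg2.
pose free : category_of K2 := exist _ (quotient t) Kt.
have free_equiv := filter_quotient_equiv (A0 := free) (q := quot_hom t)
  quasi2 alg2 (@quot_hom_surjective _ _ t).
have {}free_equiv := free_equiv
  (fun u Ku x y xy => least u Ku x y (proj1 (quot_class_eq t x y) xy)).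
have image_equiv := filter_quotient_equiv (A0 := H free)
  (q := hom_id (sval (H free))) quasi1 alg1 (fun x => ex_intro _ x erefl).
apply: (dually_stone_WEML alg2).
apply: (dually_stone_equiv (order_equiv_sym free_equiv)).
apply: (dually_stone_equiv (order_equiv_sym (quotient_equiv weqH free))).
apply: (dually_stone_equiv (image_equiv _)).
  by move=> u _ x y /= ->; exact: cong_refl.
exact: WEML_dually_stone.
Qed.
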